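(* The Niemytzki plane $L$ is $\varkappa$-metrizable.
   Context: The Niemytzki plane is the closed upper half-plane $L=\mathbb{R}\times[0,\infty)$ endowed with the topology generated by all open Euclidean discs disjoint from the real axis $L_1=\{(x,0)\colon x\in\mathbb{R}\}$ and all sets $\{p\}\cup D$, where $D\subseteq L$ is an open Euclidean disc tangent to $L_1$ at the point $p\in L_1$. A subset $U$ of a topological space $X$ is regular open if $U=\operatorname{int}\operatorname{cl}U$; $\operatorname{RO}(X)$ denotes the family of all regular open subsets of $X$. A $\varkappa$-metric on $X$ is a family of functions $\{f_U\colon U\in\operatorname{RO}(X)\}$, $f_U\colon X\to[0,1]$, such that: (1) $U=f_U^{-1}((0,1])$ for every $U\in\operatorname{RO}(X)$; (2) if $U,V\in\operatorname{RO}(X)$ and $U\subseteq V$, then $f_U(x)\leqslant f_V(x)$ for every $x\in X$; (3) each $f_U$ is continuous; (4) if $(U^\alpha)$ is a decreasing (possibly transfinite) sequence of regular open sets and $W=\operatorname{int}\bigcap_\alpha U^\alpha$, then $f_W(x)=\inf_\alpha f_{U^\alpha}(x)$ for every $x\in X$. A space $X$ is $\varkappa$-metrizable if it is a $T_0$-space, $\operatorname{RO}(X)$ is a base of $X$, and there exists a $\varkappa$-metric on $X$. *)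

(* Defs.v *)
From HB Require Import structures.
From mathcomp Require Import all_boot all_order all_algebra.
From mathcomp Require Import all_classical all_reals all_analysis.
From mathcomp Require Import wochoice.

Set Implicit Arguments.
Unset Strict Implicit.
Unset Printing Implicit Defensive.

Import Order.TTheory GRing.Theory Num.Theory.
Import numFieldNormedType.Exports.

Local Open Scope classical_set_scope.
Local Open Scope ring_scope.

Section euclidean_plane.
Context {R : realType}.
Implicit Types (c p : R * R) (r : R).

(* The library norm on R * R is the max norm, so Euclidean discs and circles
   are spelled out in coordinates. *)
Definition sqdist c p : R := (p.1 - c.1) ^+ 2 + (p.2 - c.2) ^+ 2.

Definition disc c r : set (R * R) := [set p | sqdist c p < r ^+ 2].

Definition circle c r : set (R * R) := [set p | sqdist c p = r ^+ 2].

Definition upper_half_plane : set (R * R) := [set p | 0 <= p.2].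

Definition real_axis : set (R * R) := [set p | p.2 = 0].

Definition tangent_disc c r p := circle c r `&` real_axis = [set p].

End euclidean_plane.

Definition niemytzki (R : realType) : Type := {p : R * R | 0 <= p.2}.

Section niemytzki_topology.
Variable R : realType.

HB.instance Definition _ := Choice.on (niemytzki R).

Definition plane_point (q : niemytzki R) : R * R := sval q.

Definition inner_disc : set (set (niemytzki R)) :=
  [set A | exists (c : R * R) (r : R),
    [/\ 0 < r, disc c r `<=` upper_half_plane, disc c r `&` real_axis = set0
      & A = plane_point @^-1` disc c r]].

Definition pointed_tangent_disc : set (set (niemytzki R)) :=
  [set A | exists (p c : R * R) (r : R),
    [/\ 0 < r, disc c r `<=` upper_half_plane, tangent_disc c r p
      & A = plane_point @^-1` ([set p] `|` disc c r)]].

(* The topology with subbase [inner_disc `|` pointed_tangent_disc]. *)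
HB.instance Definition _ := isSubBaseTopological.Build (niemytzki R)
  (inner_disc `|` pointed_tangent_disc) id.

End niemytzki_topology.

Section kappa_metrizable.
Variables (R : realType) (T : topologicalType).

(* A kappa-metric is represented by a function on all subsets of [T]; only its
   values on regular open sets are constrained.  Transfinite sequences are
   indexed by arbitrary well-ordered types [I], equivalent to indexing by
   ordinals.  They are required to be nonempty, since the infimum of an empty
   set of reals is 0 in the library. *)
Definition kappa_metric (f : set T -> T -> R) : Prop :=
  [/\ (forall U, regopen U -> forall x, 0 <= f U x <= 1),
      (forall U, regopen U -> U = f U @^-1` `]0, 1]),
      (forall U V, regopen U -> regopen V -> U `<=` V ->
         forall x, f U x <= f V x),
      (forall U, regopen U -> continuous (f U))
    & (forall (I : Type) (le : rel I) (U : I -> set T),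
         inhabited I -> well_order le ->
         (forall a, regopen (U a)) ->
         (forall a b, le a b -> U b `<=` U a) ->
         forall x, f (\bigcap_a U a)° x = inf [set f (U a) x | a in [set: I]])].

Definition kappa_metrizable : Prop :=
  [/\ kolmogorov_space T, basis (@regopen T)
    & exists f : set T -> T -> R, kappa_metric f].

End kappa_metrizable.

(* Main.v *)
(* For a regular open set U, the value f_U(q) is the larger of two quantities.
   The first is the least of 1, the height of q and the distance from q to the
   complement of U; it is continuous in the Euclidean topology and vanishes on
   the axis.  The second handles the axis: if q lies on the circle of radius s
   tangent to the axis at p, and the open disc of radius R tangent at p is
   contained in U, with R <= 1, it is the supremum of R - s over all such p, s
   and R.  At an axis point q only p = q and s = 0 compete, so the value is the
   radius of the largest tangent disc at q inside U (capped at 1), which is zero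
   off U because U is regular open.  Since (p, s) ranges over a compact rectangle, the maximum
   over (p, s) is upper semicontinuous and commutes with infima along chains,
   which gives both the continuity of f_U and the condition on decreasing
   sequences. *)

Require Import Defs.
From mathcomp Require Import all_boot all_order all_algebra.
From mathcomp Require Import all_classical all_reals all_analysis.
From mathcomp Require Import wochoice ring lra.

Set Implicit Arguments.
Unset Strict Implicit.
Unset Printing Implicit Defensive.

Import Order.TTheory GRing.Theory Num.Theory.
Import numFieldNormedType.Exports.

Local Open Scope classical_set_scope.
Local Open Scope ring_scope.

Section niemytzki_plane.
Variable R : realType.
Implicit Types (p s t r : R) (q z : niemytzki R) (O U : set (niemytzki R)).

(** * Neighbourhoods in the Niemytzki plane *)

Definition subbasic : set (set (niemytzki R)) :=
  @inner_disc R `|` @pointed_tangent_disc R.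

Lemma subbasic_open O : subbasic O -> open O.
Proof.
move=> bO; exists [set O]; last by rewrite bigcup_set1.
by move=> _ ->; exact: finI_from1.
Qed.

(** Basic open sets are finite intersections of subbasic ones. Applied to filters of tangent discs
    or balls, this bounds the neighbourhoods of a point from below. *)
Lemma subbasic_cvg q (F : set_system (niemytzki R)) : Filter F ->
  (forall A, subbasic A -> A q -> F A) -> F --> q.
Proof.
move=> FF Fq O; rewrite nbhsE => -[V [[D' sD' <-] [A D'A Aq]] VO].
apply: filterS VO _.
have [D sD DA] := sD' _ D'A.
suff FA : F A by apply: filterS FA => x Ax; exists A.
rewrite -DA; apply: filter_bigI => B BD.
by apply: Fq; [apply/set_mem/sD | move: Aq; rewrite -DA; apply].
Qed.

Notation abs q := (plane_point q).1.
Notation ord q := (plane_point q).2.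

Lemma ord_ge0 z : 0 <= ord z.
Proof. exact: (valP z). Qed.

Lemma plane_point_inj : injective (@plane_point R).
Proof. exact: val_inj. Qed.

(* The power of [q] with respect to the circle of radius [r] tangent to the
   axis at [(p, 0)]; it is negative exactly inside the disc. *)
Definition tangent_power p r q : R :=
  (p - abs q) ^+ 2 + ord q ^+ 2 - 2 * r * ord q.

(** Reflection in the vertical line through [c] preserves both circle and axis, so uniqueness of the
    contact point forces [c.1 = p.1]. The radius is then the modulus of [c.2], and [c] itself lies
    in the upper half-plane. *)
Lemma tangent_disc_center (c p : R * R) r : 0 < r ->
  disc c r `<=` upper_half_plane -> tangent_disc c r p ->
  [/\ c.1 = p.1, c.2 = r & p.2 = 0].
Proof.
case: c p => [c1 c2] [p1 p2] r0 cU; rewrite /tangent_disc => cp.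
have : [set (p1, p2)] (p1, p2) by [].
rewrite -cp /circle /real_axis/sqdist /= => -[/= p_r p20].
have [cp1 _] : [set (p1, p2)] (2 * c1 - p1, 0).
  by rewrite -cp; split => //; rewrite /circle /sqdist/= -p_r p20; ring.
have c2ge0 : 0 <= c2.
  apply: (cU (c1, c2)); rewrite /disc /sqdist /= !subrr; nra.
split => //; first lra.
have ec : c1 = p1 by lra.
move: p_r; rewrite ec p20 subrr sub0r expr0n add0r sqrrN => /eqP.
by rewrite eqrXn2 // ?ltW// => /eqP.
Qed.

Lemma nbhs_axis q O : ord q = 0 -> nbhs q O ->
  exists2 r, 0 < r & forall z, tangent_power (abs q) r z < 0 -> O z.
Proof.
move=> q0; pose B r := [set z | tangent_power (abs q) r z < 0].
have FF : Filter (filter_from [set r | 0 < r] B).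
  apply: filter_from_filter; first by exists 1 => /=.
  move=> r1 r2 /= r10 r20; exists (Num.min r1 r2).
    by rewrite /= lt_min r10.
  (* Discs tangent at the same point are nested, because the power decreases in the radius when
     [0 <= ord z]. *)
  move=> z; rewrite /B /= => Bz; have z0 := ord_ge0 z.
  by split; apply: (le_lt_trans _ Bz);
    rewrite lerD2l lerN2 ler_wpM2r// ler_pM2l// ge_min lexx ?orbT.
suff : filter_from [set r | 0 < r] B --> q by move=> /[apply].
apply: subbasic_cvg => A [[c [r [r0 cU c0 ->]]]|[p [c [r [r0 cU tcp ->]]]]].
  by move=> cq; have : (disc c r `&` real_axis) (plane_point q) by []; rewrite c0.
have [c1 c2 p2] := tangent_disc_center r0 cU tcp.
move=> qpc; exists r => // z; rewrite /B/= => Bz; right.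
have qp : plane_point q = p.
  case: qpc => // cq; exfalso; move: cq.
  rewrite /disc /sqdist /= q0 c2; have := sqr_ge0 (abs q - c.1); nra.
move: Bz; rewrite /disc/sqdist/tangent_power/= c1 c2 qp; nra.
Qed.

Lemma nbhs_horodisc q r : ord q = 0 -> 0 < r ->
  nbhs q [set z | z = q \/ tangent_power (abs q) r z < 0].
Proof.
move=> q0 r0; pose c := (abs q, r).
apply: open_nbhs_nbhs; split; last by left.
have -> : [set z | z = q \/ tangent_power (abs q) r z < 0] =
    @plane_point R @^-1` ([set plane_point q] `|` disc c r).
  rewrite predeqE => z; rewrite /tangent_power /disc /sqdist /c /=; split => -[].
  - by move=> ->; left.
  - by move=> h; right; nra.
  - by move=> /plane_point_inj; left.
  - by move=> h; right; nra.
apply: subbasic_open; right; exists (plane_point q), c, r; split => //.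
- move=> [w1 w2]; rewrite /disc /sqdist /upper_half_plane/=.
  by case: (leP 0 w2) => // w20; have := sqr_ge0 (w1 - abs q); nra.
- rewrite /tangent_disc predeqE => -[w1 w2].
  rewrite /circle/real_axis/sqdist/=; split=> [[e w20]|wq]; last first.
    have [-> ->] : w1 = abs q /\ w2 = ord q by rewrite -wq.
    by rewrite q0; split => //; ring.
  move: e; rewrite w20 sub0r sqrrN -[in RHS](add0r (r ^+ 2)) => /addIr/eqP.
  by rewrite sqrf_eq0 subr_eq0 => /eqP ->; rewrite [RHS]surjective_pairing q0.
Qed.

Lemma nbhs_inner q O : 0 < ord q -> nbhs q O ->
  exists2 r, 0 < r & forall z, `|plane_point q - plane_point z| < r -> O z.
Proof.
move=> q0; pose B r := [set z | `|plane_point q - plane_point z| < r].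
have FF : Filter (filter_from [set r | 0 < r] B).
  apply: filter_from_filter; first by exists 1 => /=.
  move=> r1 r2 /= r10 r20; exists (Num.min r1 r2).
    by rewrite /= lt_min r10.
  by move=> z; rewrite /B /= lt_min => /andP[].
suff : filter_from [set r | 0 < r] B --> q by move=> /[apply].
have dB c r A : disc c r (plane_point q) -> @plane_point R @^-1` disc c r `<=` A ->
    filter_from [set r | 0 < r] B A.
  move=> cq cA.
  have /nbhs_normP[e /= e0 eB] : nbhs (plane_point q) (disc c r).
    have ct : {for plane_point q, continuous (sqdist c)}.
      apply: cvgD; (apply: cvgX || apply: cvgM); apply: cvgB; try exact: cvg_cst;
      first [exact: cvg_fst|exact: cvg_snd].
    by apply: (cvgr_lt _ ct); exact: cq.
  by exists e => // z Bz; apply: cA; exact: eB.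
apply: subbasic_cvg => A [[c [r [r0 cU c0 ->]]]|[p [c [r [r0 cU tcp ->]]]]].
  by move=> cq; apply: (dB c r).
have [c1 c2 p2] := tangent_disc_center r0 cU tcp.
move=> qpc; apply: (dB c r); last by move=> z; right.
by case: qpc => // qp; move: q0; rewrite qp p2 ltxx.
Qed.

(** * Comparison with the Euclidean topology, and the T0 axiom *)

Lemma continuous_plane_point : continuous (@plane_point R).
Proof.
move=> q; apply/(@cvgrPdist_lt _ _ _ _ (nbhs_filter q)) => /= e e0.
have := ord_ge0 q; rewrite le_eqVlt => /orP[/eqP/esym q0|q0].
  (* The tangent disc of radius [e / 2] has height and width [e], so it fits in the max-norm ball of
     radius [e] about [q]. *)
  have e20 : 0 < e / 2 by rewrite divr_gt0.
  apply: filterS (nbhs_horodisc q0 e20).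
  move=> z [->|]; first by rewrite subrr normr0.
  have z0 := ord_ge0 z; rewrite /tangent_power => qz.
  have dx0 := sqr_ge0 (abs q - abs z).
  have qz' : ord z < e by nra.
  rewrite prod_normE/= gt_max q0 sub0r normrN (ger0_norm z0) qz' andbT.
  by rewrite ltr_norml; apply/andP; split; nra.
(* The bound by [ord q] keeps the disc off the axis. *)
pose r := Num.min e (ord q).
have r0 : 0 < r by rewrite lt_min e0.
have [re rq] : r <= e /\ r <= ord q by rewrite !ge_min !lexx orbT.
have : nbhs q (@plane_point R @^-1` disc (plane_point q) r).
  apply: open_nbhs_nbhs; split; last by rewrite /= /disc /sqdist /= !subrr; nra.
  apply: subbasic_open; left; exists (plane_point q), r; split => //.
    move=> [w1 w2]; rewrite /disc /sqdist /upper_half_plane/=.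
    by case: (leP 0 w2) => // w20; have := sqr_ge0 (w1 - abs q); nra.
  rewrite -subset0 => -[w1 w2]; rewrite /disc /sqdist /real_axis/= => -[+ w20].
  by have := sqr_ge0 (w1 - abs q); rewrite w20; nra.
apply: filterS => z; rewrite /disc /sqdist/= => qz.
have h1 := sqr_ge0 (abs z - abs q); have h2 := sqr_ge0 (ord z - ord q).
by rewrite prod_normE/= gt_max !ltr_norml; apply/andP; split;
  apply/andP; split; nra.
Qed.

Lemma niemytzki_kolmogorov : kolmogorov_space (niemytzki R).
Proof.
move=> q z qz.
have d0 : 0 < `|plane_point q - plane_point z|.
  by rewrite normr_gt0 subr_eq0 (inj_eq plane_point_inj).
exists [set w | `|plane_point q - plane_point w| < `|plane_point q - plane_point z|].
left; split; apply/mem_set; last by rewrite /= ltxx.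
by move/(@cvgrPdist_lt _ _ _ _ (nbhs_filter q)): (@continuous_plane_point q); apply.
Qed.

Lemma cvg_plane_point (T : Type) (F : set_system T) (u : T -> niemytzki R) q :
  Filter F -> u @ F --> q -> plane_point (u x) @[x --> F] --> plane_point q.
Proof.
by move=> FF uq; apply: cvg_comp; [exact: uq|exact: continuous_plane_point].
Qed.

Lemma cvg_ord (T : Type) (F : set_system T) (u : T -> niemytzki R) q :
  Filter F -> u @ F --> q -> ord (u x) @[x --> F] --> ord q.
Proof.
move=> FF /cvg_plane_point uq.
by apply: cvg_comp; [exact: uq|exact: cvg_snd].
Qed.

Lemma cvg_abs (T : Type) (F : set_system T) (u : T -> niemytzki R) q :
  Filter F -> u @ F --> q -> abs (u x) @[x --> F] --> abs q.
Proof.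
move=> FF /cvg_plane_point uq.
by apply: cvg_comp; [exact: uq|exact: cvg_fst].
Qed.

Lemma cvg_plane_dist (T : Type) (F : set_system T) (u v : T -> niemytzki R) q z :
  Filter F -> u @ F --> q -> v @ F --> z ->
  `|plane_point (u x) - plane_point (v x)| @[x --> F] -->
  `|plane_point q - plane_point z|.
Proof.
by move=> FF uq vz; apply: cvg_norm; apply: cvgB; exact: cvg_plane_point.
Qed.

Lemma cvg_tangent_power (T : Type) (F : set_system T) (p r : T -> R)
    (u : T -> niemytzki R) p0 r0 q : Filter F ->
  p @ F --> p0 -> r @ F --> r0 -> u @ F --> q ->
  tangent_power (p x) (r x) (u x) @[x --> F] --> tangent_power p0 r0 q.
Proof.
move=> FF pp0 rr0 uq.
have abq := cvg_abs FF uq; have orq := cvg_ord FF uq.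
apply: cvgB; last by apply: cvgM => //; apply: cvgM => //; exact: cvg_cst.
by apply: cvgD; apply: cvgM => //; exact: cvgB.
Qed.

Lemma continuous_tangent_power p r : continuous (tangent_power p r).
Proof.
move=> q; exact: (@cvg_tangent_power _ (nbhs q) (fun=> p) (fun=> r) id p r q
  (nbhs_filter q) (cvg_cst p) (cvg_cst r) (@cvg_id _ (nbhs q))).
Qed.

(** * Regularity and the base of regular open sets *)

Lemma closed_neighborhoods q O : nbhs q O ->
  exists C, [/\ closed C, nbhs q C & C `<=` O].
Proof.
move=> qO; have := ord_ge0 q; rewrite le_eqVlt => /orP[/eqP/esym q0|q0].
  have [r r0 rO] := nbhs_axis q0 qO.
  (* The closed disc of half the radius meets the axis only at [q]; its other points lie strictly
     inside the disc of radius [r]. *)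
  exists [set z | tangent_power (abs q) (r / 2) z <= 0]; split.
  - apply: (@closed_comp _ _ (tangent_power (abs q) (r / 2)) [set x | x <= 0]).
      by move=> z _; exact: continuous_tangent_power.
    exact: closed_le.
  - have r20 : 0 < r / 2 by rewrite divr_gt0.
    apply: filterS (nbhs_horodisc q0 r20) => z [->|/ltW//].
    by rewrite /tangent_power /= q0 subrr; lra.
  - move=> z; rewrite /tangent_power /= => zr; have z0 := ord_ge0 z.
    have [z00|/eqP zn0] := eqVneq (ord z) 0.
      suff -> : z = q by exact: nbhs_singleton.
      apply: plane_point_inj; rewrite [LHS]surjective_pairing [RHS]surjective_pairing.
      rewrite z00 q0; congr pair; apply/eqP; rewrite eq_sym -subr_eq0 -sqrf_eq0.
      by rewrite eq_le sqr_ge0 andbT; move: zr; rewrite z00; lra.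
    by apply: rO; rewrite /tangent_power; nra.
have [r r0 rO] := nbhs_inner q0 qO.
have cd : continuous (fun z : niemytzki R => `|plane_point q - plane_point z|).
  move=> z; exact: (@cvg_plane_dist _ (nbhs z) (fun=> q) id q z
    (nbhs_filter z) (cvg_cst q) (@cvg_id _ (nbhs z))).
exists [set z | `|plane_point q - plane_point z| <= r / 2]; split.
- apply: (@closed_comp _ _
    (fun z : niemytzki R => `|plane_point q - plane_point z|)
    [set x | x <= r / 2]).
    by move=> z _; exact: cd.
  exact: closed_le.
- have : `|plane_point q - plane_point q| < r / 2 by rewrite subrr normr0 divr_gt0.
  move/(@cvgr_lt _ _ _ (nbhs_filter q) _ _ (cd q)).
  by apply: filterS => z /ltW.
- by move=> z /= zr; apply: rO; lra.
Qed.

Lemma regopen_basis : basis (@regopen (niemytzki R)).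
Proof.
split; first by move=> U <-; exact: open_interior.
move=> q O qO; have [C [cC qC CO]] := closed_neighborhoods qO.
exists C° => /=; last exact: subset_trans (@interior_subset _ C) CO.
by split=> //; exact: interior_closed_regopen.
Qed.

(** * The functions [kappa U] and their positivity sets *)

(* The numbers [t] below the first, respectively the second, quantity of the
   header; quantifying over [s] such that [q] is inside the closed disc of radius
   [s] avoids dividing by the height of [q], which may be 0. *)
Definition metric_level U q t := [/\ t <= 1, t <= ord q &
  forall z, ~ U z -> t <= `|plane_point q - plane_point z|].

Definition horo_level U q t p s := [/\ 0 <= s, t + s <= 1,
  tangent_power p s q <= 0 &
  forall z, ~ U z -> 0 <= tangent_power p (t + s) z].

(** Including 0 keeps the set nonempty, so that its supremum is never a default value. *)
Definition level U q : set R :=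
  [set t | [\/ t = 0, metric_level U q t | exists p s, horo_level U q t p s]].

Definition kappa U q : R := sup (level U q).

Lemma level0 U q : level U q 0.
Proof. exact: Or31. Qed.

Lemma level_le1 U q : ubound (level U q) 1.
Proof. by move=> t [->|[]//|[p [s [s0 ts _ _]]]] //; lra. Qed.

Lemma level_down U q t t' : 0 <= t' <= t -> level U q t -> level U q t'.
Proof.
move=> /andP[t'0 t't] [t0|[t1 tq tU]|[p [s [s0 ts1 psq psU]]]].
- by apply: Or31; lra.
- by apply: Or32; split; [lra|lra|move=> z /tU; lra].
- apply: Or33; exists p, s; split => //; first lra.
  move=> z /psU; have := ord_ge0 z; rewrite /tangent_power; nra.
Qed.

Lemma level_mono U V q : U `<=` V -> level U q `<=` level V q.
Proof.
move=> UV t [t0|[t1 tq tU]|[p [s [s0 ts1 psq psU]]]]; first exact: Or31.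
- by apply: Or32; split => // z Vz; apply: tU => /UV.
- by apply: Or33; exists p, s; split => // z Vz; apply: psU => /UV.
Qed.

Lemma le_kappa U q t : level U q t -> t <= kappa U q.
Proof. by apply: ub_le_sup; exists 1; exact: level_le1. Qed.

Lemma lt_kappa U q t : 0 <= t < kappa U q -> level U q t.
Proof.
move=> /andP[t0 tk]; have [|t' Ut' tt'] := sup_gt _ tk.
  by exists 0; exact: level0.
by apply: level_down Ut'; rewrite t0 ltW.
Qed.

Lemma kappa_ge0 U q : 0 <= kappa U q.
Proof. exact/le_kappa/level0. Qed.

Lemma kappa_le1 U q : kappa U q <= 1.
Proof. by apply: ge_sup; [exists 0; exact: level0|exact: level_le1]. Qed.

Lemma kappa_mono U V q : U `<=` V -> kappa U q <= kappa V q.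
Proof.
move=> UV; apply: ge_sup; first by exists 0; exact: level0.
by move=> t /(level_mono UV); exact: le_kappa.
Qed.

Lemma open_level U q : open U -> U q -> exists2 t, 0 < t & level U q t.
Proof.
move=> oU Uq; have qU : nbhs q U by exact: open_nbhs_nbhs.
have := ord_ge0 q; rewrite le_eqVlt => /orP[/eqP/esym q0|q0].
  have [r r0 rU] := nbhs_axis q0 qU.
  exists (Num.min r 1); first by rewrite lt_min r0 ltr01.
  have [rr r1] : Num.min r 1 <= r /\ Num.min r 1 <= 1 by rewrite !ge_min !lexx orbT.
  (* For [s = 0] the closed inner disc degenerates to the point [q]. *)
  apply: Or33; exists (abs q), 0; split => //; first by rewrite addr0.
    by rewrite /tangent_power q0 subrr; lra.
  move=> z nUz; rewrite addr0 leNgt; apply/negP => h; apply/nUz/rU.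
  by move: h; have := ord_ge0 z; rewrite /tangent_power; nra.
have [r r0 rU] := nbhs_inner q0 qU.
exists (Num.min r (Num.min (ord q) 1)); first by rewrite !lt_min r0 q0 ltr01.
apply: Or32; split; rewrite ?ge_min ?lexx ?orbT//.
move=> z nUz; rewrite ge_min; apply/orP; left.
by rewrite leNgt; apply/negP => h; exact/nUz/rU.
Qed.

(** If [q] is outside [U], only the tangent disc case is possible, and there [q] is the contact
    point. The disc lies in [U] and accumulates at [q], so [q] is interior to the closure of [U],
    which is [U]. *)
Lemma regopen_level U q t : regopen U -> 0 < t -> level U q t -> U q.
Proof.
move=> rU t0 Uq; apply: contrapT => nUq; apply: (nUq).
case: Uq => [|[_ _ /(_ _ nUq)]|[p [s [s0 ts psq psU]]]].
- by move=> t00; rewrite t00 ltxx in t0.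
- by rewrite subrr normr0 leNgt t0.
have q0 : ord q = 0.
  apply/eqP; rewrite eq_le ord_ge0 andbT.
  by have := psU _ nUq; move: psq; rewrite /tangent_power; nra.
have pq : p = abs q.
  move: psq; rewrite /tangent_power q0 => psq.
  apply/eqP; rewrite -subr_eq0 -sqrf_eq0 eq_le sqr_ge0 andbT; lra.
have r0 : 0 < t + s by lra.
rewrite pq in psU; rewrite -rU.
apply: filterS (nbhs_horodisc q0 r0) => z [->|zq]; last first.
  by apply: subset_closure; apply: contrapT => /psU; rewrite leNgt zq.
move=> O /(nbhs_axis q0)[r r'0 rO].
(* The point at height [h] above [q] lies in both tangent discs at [q], of radii [r] and [t + s]. *)
pose h := Num.min r (t + s).
have h0 : 0 < h by rewrite lt_min r'0.
have [hr hts] : h <= r /\ h <= t + s by rewrite !ge_min !lexx orbT.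
pose w : niemytzki R := exist (fun x : R * R => 0 <= x.2) (abs q, h) (ltW h0).
exists w; split; last by apply: rO; rewrite /tangent_power /= subrr; nra.
by apply: contrapT => /psU; rewrite /tangent_power /= subrr; nra.
Qed.

(** * Continuity of [kappa U] and decreasing chains *)

(** This gives lower semicontinuity. Replacing [s] by [s + d] leaves the outer radius [t + s]
    unchanged and makes the inner disc a neighbourhood of [q]; on the axis this neighbourhood is the
    tangent disc at [q] itself. *)
Lemma near_level U q t d : 0 < d -> level U q t -> 0 < t - d ->
  \forall z \near q, level U z (t - d).
Proof.
move=> d0 [t0 td0|[t1 tq tU] _|[p [s [s0 ts1 psq psU]]] td0].
- by exfalso; lra.
- have := @cvg_plane_point _ _ id q (nbhs_filter q) (@cvg_id _ (nbhs q)).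
  move=> /(@cvgrPdist_lt _ _ _ _ (nbhs_filter q))/(_ _ d0).
  apply: filterS => z /= qz; apply: Or32; split; first lra.
    have := ler_norm (ord q - ord z).
    suff : `|ord q - ord z| < d by lra.
    by apply: le_lt_trans qz; rewrite prod_normE/= le_max lexx orbT.
  move=> w /tU qw.
  have := ler_distD (plane_point z) (plane_point q) (plane_point w); lra.
have [q0|/eqP q0] := eqVneq (ord q) 0; last first.
  have := continuous_tangent_power (p := p) (r := s + d) (x := q).
  have : tangent_power p (s + d) q < 0.
    by move: psq; have := ord_ge0 q; rewrite /tangent_power; nra.
  move=> h /(@cvgr_lt _ _ _ (nbhs_filter q) _ _)/(_ _ h).
  apply: filterS => z /ltW zp; apply: Or33; exists p, (s + d); split => //; try lra.
  by have -> : t - d + (s + d) = t + s by lra.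
have pq : p = abs q.
  move: psq; rewrite /tangent_power q0 => psq.
  apply/eqP; rewrite -subr_eq0 -sqrf_eq0 eq_le sqr_ge0 andbT; lra.
have sd0 : 0 < s + d by lra.
apply: filterS (nbhs_horodisc q0 sd0) => z zq.
apply: Or33; exists p, (s + d); split; try lra.
  by rewrite pq; case: zq => [->|/ltW//]; rewrite /tangent_power q0 subrr; lra.
by have -> : t - d + (s + d) = t + s by lra.
Qed.

(* With constant [V] this is upper semicontinuity of [kappa]; with constant [u]
   and [F] the tails of a chain it is the condition on decreasing sequences. *)
Lemma near_not_level (I : Type) (F : set_system I) (V : I -> set (niemytzki R))
    (u : I -> niemytzki R) W q t : Filter F -> u @ F --> q ->
  (forall z O, ~ W z -> nbhs z O -> \forall i \near F, exists2 w, O w & ~ V i w) ->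
  0 < t -> ~ level W q t -> \forall i \near F, ~ level (V i) (u i) t.
Proof.
move=> FF uq VW t0 nWt.
have metric : \forall i \near F, ~ metric_level (V i) (u i) t.
  have [t1|t1] := ltP 1 t; first by apply: nearW => i -[]; lra.
  have [tq|tq] := ltP (ord q) t.
    apply: (@filterS _ _ FF _ _ _
      (@cvgr_lt _ _ F FF _ _ (cvg_ord FF uq) _ tq)) => i ti [] _.
    lra.
  have [z nWz qz] : exists2 z, ~ W z & `|plane_point q - plane_point z| < t.
    apply: contrapT => nz; apply: nWt; apply: Or32; split => // z nWz.
    by rewrite leNgt; apply/negP => h; apply: nz; exists z.
  have : \forall iz \near filter_prod F (nbhs z),
      `|plane_point (u iz.1) - plane_point iz.2| < t.
    apply: (cvgr_lt _ _ _ qz); apply: cvg_plane_dist; last exact: cvg_snd.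
    by apply: cvg_comp; [exact: cvg_fst|exact: uq].
  move=> [[A O] /= [FA zO] AO].
  apply: (@filterS _ _ FF _ _ _ (filterI FA (VW z O nWz zO))).
  move=> i [Ai [w Ow nVw]].
  move=> [_ _ /(_ w nVw)]; have := AO (i, w) (conj Ai Ow) => /=; lra.
(* If [u i] is within 1 of [q] in both coordinates and in a closed disc of radius [s <= 1] tangent
   at [p], then [p] is within [ord q + 2] of [abs (u i)], hence within [c] of [abs q]. *)
pose c := ord q + 3.
pose K := `[abs q - c, abs q + c] `*` `[0, 1] : set (R * R).
have cK : compact K by apply: compact_setX; exact: segment_compact.
have : \forall i \near F, K `<=` [set ps | ~ horo_level (V i) (u i) t ps.1 ps.2].
  (* Each [(p, s)] in [K] violates a condition of [horo_level W q t]. The violation is an open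
     condition and persists near [(p, s)] along [F]; compactness makes it uniform on [K]. *)
  move/compact_near_coveringP : cK => /(_ I F
    (fun i ps => ~ horo_level (V i) (u i) t ps.1 ps.2) FF); apply.
  move=> [p s] [/= _]; rewrite in_itv/= => /andP[s0 _].
  have cp : x.1.1 @[x --> filter_prod (nbhs (p, s)) F] --> p.
    by apply: cvg_comp; [exact: cvg_fst|exact: cvg_fst].
  have cs : x.1.2 @[x --> filter_prod (nbhs (p, s)) F] --> s.
    by apply: cvg_comp; [exact: cvg_fst|exact: cvg_snd].
  have [ts|ts] := ltP 1 (t + s).
    have ts1 : 1 - t < s by lra.
    by apply: (filterS _ (cvgr_gt _ cs _ ts1)) => x h []; lra.
  have [psq|psq] := ltP 0 (tangent_power p s q).
    have cu : u x.2 @[x --> filter_prod (nbhs (p, s)) F] --> q.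
      by apply: cvg_comp; [exact: cvg_snd|exact: uq].
    apply: (filterS _ (cvgr_gt _ (cvg_tangent_power _ cp cs cu) _ psq)) => x h [].
    lra.
  have [z nWz psz] : exists2 z, ~ W z & tangent_power p (t + s) z < 0.
    apply: contrapT => nz; apply: nWt; apply: Or33; exists p, s; split => // z nWz.
    by rewrite leNgt; apply/negP => h; apply: nz; exists z.
  have : \forall x \near filter_prod (nbhs (p, s)) (nbhs z),
      tangent_power x.1.1 (t + x.1.2) x.2 < 0.
    apply: (cvgr_lt _ _ _ psz); apply: cvg_tangent_power; last exact: cvg_snd.
      by apply: cvg_comp; [exact: cvg_fst|exact: cvg_fst].
    apply: cvgD; first exact: cvg_cst.
    by apply: cvg_comp; [exact: cvg_fst|exact: cvg_snd].
  move=> [[A O] /= [pA zO] AO].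
  exists (A, [set i | exists2 w, O w & ~ V i w]).
    by split; [exact: pA|exact: (VW z O nWz zO)].
  move=> [ps i] /= [Aps [w Ow nVw]] [_ _ _ /(_ w nVw)].
  by have := AO (ps, w) (conj Aps Ow) => /=; lra.
have oq1 : ord q < ord q + 1 by lra.
have aq1 : 0 < 1 :> R by [].
have ord1 := @cvgr_lt _ _ F FF _ _ (cvg_ord FF uq) _ oq1.
have abs1 := (@cvgrPdist_lt _ _ _ F FF _ _).1 (cvg_abs FF uq) _ aq1.
move=> horo; apply: (@filterS _ _ FF _ _ _
  (filterI (filterI ord1 abs1) (filterI metric horo))) => i [[/= o1]].
rewrite ltr_norml.
move=> /andP[a1 a2] [mi hi] [t00|//|].
  by rewrite t00 ltxx in t0.
move=> [p [s psi]]; apply: (hi (p, s) _ psi).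
case: psi => s0 ts1 psi _; split; rewrite /= in_itv/=; last by apply/andP; split; lra.
move: psi; rewrite /tangent_power => psi.
have u0 := ord_ge0 (u i).
have : (p - abs (u i)) ^+ 2 <= (ord q + 2) ^+ 2 by have := ord_ge0 q; nra.
have q2 : 0 <= ord q + 2 by have := ord_ge0 q; lra.
rewrite -ler_sqrt ?sqr_ge0// !sqrtr_sqr (ger0_norm q2) ler_norml /c => /andP[h1 h2].
by apply/andP; split; lra.
Qed.

Lemma continuous_kappa U : continuous (kappa U).
Proof.
move=> q; apply/(@cvgrPdist_le _ _ _ _ (nbhs_filter q)) => /= e e0.
have lower : \forall z \near q, kappa U q - e <= kappa U z.
  have [ke|ke] := leP (kappa U q) e.
    by apply: (@filterE _ _ (nbhs_filter q)) => z; have := kappa_ge0 U z; lra.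
  (* One half of [e] pays for a supremum that may not be attained, the other for the loss in
     [near_level]. *)
  have e20 : 0 < e / 2 by rewrite divr_gt0.
  have Uq : level U q (kappa U q - e / 2) by apply: lt_kappa; lra.
  have k0 : 0 < kappa U q - e / 2 - e / 2 by lra.
  by apply: filterS (near_level e20 Uq k0) => z /le_kappa; lra.
have upper : \forall z \near q, kappa U z <= kappa U q + e.
  have ke0 : 0 < kappa U q + e by have := kappa_ge0 U q; lra.
  have nUq : ~ level U q (kappa U q + e) by move=> /le_kappa; lra.
  have UU z O : ~ U z -> nbhs z O -> \forall i \near q, exists2 w, O w & ~ U w.
    move=> nUz zO; apply: (@filterE _ _ (nbhs_filter q)) => _.
    by exists z => //; exact: nbhs_singleton.
  have := near_not_level (nbhs_filter q) (@cvg_id _ (nbhs q)) UU ke0 nUq.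
  apply: filterS => z nUz; rewrite leNgt; apply/negP => h; apply: nUz.
  by apply: lt_kappa; rewrite ltW.
by apply: filterS2 lower upper => z; rewrite ler_norml => h1 h2; apply/andP; split; lra.
Qed.

Lemma kappa_chain (I : Type) (U : I -> set (niemytzki R)) q :
  inhabited I -> (forall a b, U a `<=` U b \/ U b `<=` U a) ->
  kappa (\bigcap_a U a)° q = inf [set kappa (U a) q | a in [set: I]].
Proof.
move=> [i0] totU; set W := (\bigcap_a U a)°; set S := [set _ | _ in _].
have S0 : S !=set0 by exists (kappa (U i0) q), i0.
apply/eqP; rewrite eq_le; apply/andP; split.
  apply: lb_le_inf => // _ [i _ <-]; apply: kappa_mono.
  by move=> z /interior_subset; apply.
rewrite leNgt; apply/negP => kS.
pose t := (kappa W q + inf S) / 2.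
have k0 := kappa_ge0 W q.
have [t0 kt tS] : [/\ 0 < t, kappa W q < t & t < inf S] by rewrite /t; split; lra.
have lS : has_lbound S by exists 0 => _ [i _ <-]; exact: kappa_ge0.
(* The filter of tails of the chain; comparability of the members makes it closed under
   intersection. *)
pose F := filter_from [set: I] (fun a => [set b | U b `<=` U a]).
have FF : ProperFilter F.
  apply: filter_from_proper; last by move=> a _; exists a => /=.
  apply: filter_fromT_filter; first by exists i0.
  move=> a b; have [ab|ba] := totU a b.
    by exists a => d da; split => //=; exact: subset_trans da ab.
  by exists b => d db; split => //=; exact: subset_trans db ba.
(* A neighbourhood of a point outside [W] leaves some [U a], hence every smaller member of the
   chain. *)
have UW z O : ~ W z -> nbhs z O -> \forall i \near F, exists2 w, O w & ~ U i w.
  move=> nWz zO; have [w Ow [a nUaw]] : exists2 w, O w & exists a, ~ U a w.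
    apply: contrapT => nO; apply: nWz; apply: filterS zO => w Ow a _.
    by apply: contrapT => nUaw; apply: nO; exists w => //; exists a.
  by exists a => // b Uba; exists w => // /Uba.
have nWt : ~ level W q t by move=> /le_kappa; lra.
have [i nUi] := filter_ex (near_not_level _ (cvg_cst q) UW t0 nWt).
apply: nUi; apply: lt_kappa; rewrite ltW//=; apply: lt_le_trans tS _.
by apply: ge_inf => //; exists i.
Qed.

End niemytzki_plane.

(** * Totality of well-orders and the conclusion *)

Lemma well_order_total (T : Type) (le : rel T) : well_order le -> total le.
Proof.
(* The least element of the pair [x], [y] is below the other one. *)
move=> wo x y; pose A : {pred T} := [pred z | `[< z = x \/ z = y >]].
have Ax : x \in A by apply/asboolP; left.
have Ay : y \in A by apply/asboolP; right.
have [|z [[Az lz] _]] := wo A; first by exists x.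
have zx := lz _ Ax; have zy := lz _ Ay.
by move/asboolP: Az => [] <-; rewrite ?zx ?zy ?orbT.
Qed.

Theorem theorem9 (R : realType) : kappa_metrizable R (niemytzki R).
Proof.
split; [exact: niemytzki_kolmogorov|exact: regopen_basis|].
exists (@kappa R); split.
- by move=> U _ x; rewrite kappa_ge0 kappa_le1.
- move=> U rU; rewrite predeqE => q; rewrite /= in_itv/= kappa_le1 andbT; split.
    have oU : open U by rewrite -rU; exact: open_interior.
    by move=> /(open_level oU)[t t0 /le_kappa]; exact: lt_le_trans.
  (* Half of the supremum is strictly below it, hence a level. *)
  move=> k0; apply: (@regopen_level _ _ _ (kappa U q / 2)) => //.
    by rewrite divr_gt0.
  by apply: lt_kappa; lra.
- by move=> U V _ _ UV x; exact: kappa_mono.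
- by move=> U _; exact: continuous_kappa.
move=> I le U I0 wo rU leU q; apply: kappa_chain => // a b.
by have /orP[/leU ?|/leU ?] := well_order_total wo a b; [right|left].
Qed.
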